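(* Let $F$ be a real quadratic field with discriminant $\Delta_F$, and let $\sigma,\sigma':F\to\mathbb{R}$ be its two real embeddings, sending $\sqrt{\Delta_F}$ to $\sqrt{\Delta_F}$ and to $-\sqrt{\Delta_F}$ respectively. Let $I=\mathbb{Z}+\mathbb{Z}f$ be a reduced fractional ideal of $F$, where $f\in F$ is the unique element with $I=\mathbb{Z}+\mathbb{Z}f$, $\sigma(f)>1$ and $-1<\sigma'(f)<0$. Then $I$ is not $1$-reduced if and only if $N(f-1/2)>-3/4$.
   Context: $N(x)=\sigma(x)\sigma'(x)$ denotes the field norm of $x\in F$ over $\mathbb{Q}$. A fractional ideal $I$ of $F$ is called reduced if $1$ is minimal in $I$: that is, $1\in I$, and if $g\in I$ satisfies $|\sigma(g)|<1$ and $|\sigma'(g)|<1$ then $g=0$. Every reduced ideal of a real quadratic field can be written as $\mathbb{Z}+\mathbb{Z}f$ for a unique $f\in F$ with $\sigma(f)>1$ and $-1<\sigma'(f)<0$. For $u=(u_1,u_2)\in(\mathbb{R}_{>0})^2$ and $g\in F$ put $\|g\|_u=\sqrt{u_1^2\sigma(g)^2+u_2^2\sigma'(g)^2}$. The element $1$ is called primitive in $I$ if $1\in I$ and $1$ is not divisible in $I$ by any integer $d\ge 2$ (i.e. $1/d\notin I$ for all integers $d\ge2$). A fractional ideal $I$ is called $1$-reduced if $1$ is primitive in $I$ and there exists $u\in(\mathbb{R}_{>0})^2$ such that $\|1\|_u\le\|g\|_u$ for all $g\in I\setminus\{0\}$. *)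

(* Defs.v *)
From HB Require Import structures.
From mathcomp Require Import all_boot all_order all_algebra all_field.
From mathcomp Require Import classical_sets reals.

Set Implicit Arguments.
Unset Strict Implicit.
Unset Printing Implicit Defensive.

Import Order.TTheory GRing.Theory Num.Theory.
Local Open Scope classical_set_scope.
Local Open Scope ring_scope.

Definition ring_of_integers (F : fieldExtType rat) : set F :=
  [set x | integralOver (intr : int -> F) x].
Arguments ring_of_integers F : clear implicits.

Definition field_trace (F : fieldExtType rat) (x : F) : rat :=
  \tr (passmx.mxof (vbasis {:F}) (vbasis {:F}) (amulr x)).

Definition integral_basis (F : fieldExtType rat)
    (b : (\dim {:F}).-tuple F) : Prop :=
  ring_of_integers F =
  [set x | exists c : 'I_(\dim {:F}) -> int,
             x = \sum_i (c i)%:~R * tnth b i].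

Definition is_discriminant (F : fieldExtType rat) (D : int) : Prop :=
  exists2 b : (\dim {:F}).-tuple F, integral_basis b &
    D%:~R = \det (\matrix_(i, j) field_trace (tnth b i * tnth b j)) :> rat.

(* Fractional ideals are taken over the maximal order, and are nonzero. *)
Definition fractional_ideal (F : fieldExtType rat) (I : set F) : Prop :=
  [/\ exists2 x, I x & x != 0,
      forall x y, I x -> I y -> I (x - y),
      forall a x, ring_of_integers F a -> I x -> I (a * x)
    & exists2 d, ring_of_integers F d /\ d != 0 &
        forall x, I x -> ring_of_integers F (d * x)].

Definition Zspan1 (F : fieldExtType rat) (f : F) : set F :=
  [set x | exists m n : int, x = m%:~R + n%:~R * f].

Definition quad_norm (R : realType) (F : fieldExtType rat)
    (sigma sigma' : {rmorphism F -> R}) (x : F) : R :=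
  sigma x * sigma' x.

(* [reduced] and [one_reduced] are meant for fractional ideals; that assumption
   is kept as a separate hypothesis on [I]. *)
Definition reduced (R : realType) (F : fieldExtType rat)
    (sigma sigma' : {rmorphism F -> R}) (I : set F) : Prop :=
  I 1 /\
  forall g, I g -> `|sigma g| < 1 -> `|sigma' g| < 1 -> g = 0.

Definition unorm (R : realType) (F : fieldExtType rat)
    (sigma sigma' : {rmorphism F -> R}) (u : R * R) (g : F) : R :=
  Num.sqrt (u.1 ^+ 2 * sigma g ^+ 2 + u.2 ^+ 2 * sigma' g ^+ 2).

Definition primitive1 (F : fieldExtType rat) (I : set F) : Prop :=
  I 1 /\ forall d : nat, (2 <= d)%N -> ~ I (d%:R^-1).

Definition one_reduced (R : realType) (F : fieldExtType rat)
    (sigma sigma' : {rmorphism F -> R}) (I : set F) : Prop :=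
  primitive1 I /\
  exists u : R * R, [/\ 0 < u.1, 0 < u.2 &
    forall g, I g -> g != 0 ->
      unorm sigma sigma' u 1 <= unorm sigma sigma' u g].

(* Main.v *)
Require Import Defs.
From HB Require Import structures.
From mathcomp Require Import all_boot all_order all_algebra all_field.
From mathcomp Require Import classical_sets reals.
From mathcomp Require Import ring lra.

(** Write [a = sigma f > 1] and [b = sigma' f], [-1 < b < 0].  A vector [u] of
    weights only matters through [A = u_1 ^+ 2] and [B = u_2 ^+ 2], and
    [||m + n f||_u ^+ 2] is the binary quadratic form
    [A (m + n a) ^+ 2 + B (m + n b) ^+ 2].  This form is [A + B] times
    [|m + n z| ^+ 2] for a point [z] of the upper half-plane which, as [A : B]
    varies, runs through the geodesic from [b] to [a]; and [1] is shortest
    exactly when [|m + n z| >= 1] for all nonzero [(m, n)].  A point of the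
    geodesic with this property exists only if the geodesic passes above or
    through the corner [1/2 + i sqrt 3 / 2] where the unit circles around [0]
    and [1] cross: its part left of [1/2] otherwise lies in the disc around
    [0], and its part right of [1/2] in the disc around [1].  The height of the
    geodesic over [1/2] has square [(a - 1/2) (1/2 - b) = - N (f - 1/2)],
    whence the comparison with [3/4].

    If [- N (f - 1/2) >= 3/4], the weights [A = 1/2 - b], [B = a - 1/2] of
    the geodesic's point over [1/2] make the form dominate a multiple of
    [m ^+ 2 + m n + n ^+ 2], which is at least [1] on nonzero integer pairs
    ([midpoint_form_lower_bound]).  Conversely, comparing [1] with just [f]
    and [f - 1], that is with the discs around [0] and [1], bounds [A / B] from
    below and from above, and the two bounds are compatible only if
    [- N (f - 1/2) >= 3/4] ([weights_force_norm_bound]).  Primitivity of [1]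
    is automatic, since [1, f] is a basis of the ideal. *)

Set Implicit Arguments.
Unset Strict Implicit.
Unset Printing Implicit Defensive.

Import Order.TTheory GRing.Theory Num.Theory.
Local Open Scope ring_scope.

Lemma eisenstein_form_ge1 (m n : int) :
  (m, n) != (0, 0) -> 1 <= m ^+ 2 + m * n + n ^+ 2.
Proof.
rewrite xpair_eqE negb_and -gtz0_ge1 => mn_neq0.
have [n0|n_neq0] := eqVneq n 0.
  move: mn_neq0; rewrite n0 eqxx orbF => m_neq0.
  by rewrite mulr0 expr0n !addr0 exprn_even_gt0.
have n2_gt0 : 0 < n ^+ 2 by rewrite exprn_even_gt0.
have := sqr_ge0 (2 * m + n); nra.
Qed.

Lemma midpoint_form_lower_bound (R : realFieldType) (a b : R) (m n : int) :
  b < a -> (a - 2^-1) * (b - 2^-1) <= - (3 / 4) -> (m, n) != (0, 0) ->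
  a - b <= (2^-1 - b) * (m%:~R + n%:~R * a) ^+ 2
           + (a - 2^-1) * (m%:~R + n%:~R * b) ^+ 2.
Proof.
move=> ba Nle /eisenstein_form_ge1.
rewrite -(ler_int R) !rmorphD !rmorphXn rmorphM /= => form_ge1.
set x : R := m%:~R in form_ge1 *; set y : R := n%:~R in form_ge1 *.
have -> : (2^-1 - b) * (x + y * a) ^+ 2 + (a - 2^-1) * (x + y * b) ^+ 2
  = (a - b) * ((x ^+ 2 + x * y + y ^+ 2)
               + y ^+ 2 * (- (3 / 4) - (a - 2^-1) * (b - 2^-1))) by field.
rewrite ler_peMr ?subr_ge0 ?(ltW ba) //.
by apply: (le_trans form_ge1); rewrite lerDl mulr_ge0 ?sqr_ge0 ?subr_ge0.
Qed.

(** The hypotheses read [A (a ^+ 2 - 1) >= B (1 - b ^+ 2)] and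
    [A a (2 - a) <= B b (b - 2)].  For [a >= 2] the conclusion is immediate;
    otherwise eliminating [A / B] leaves a product with the positive
    factor [a - b]. *)
Lemma weights_force_norm_bound (R : realFieldType) (A B a b : R) :
  0 < A -> 0 < B -> 1 < a -> -1 < b -> b < 0 ->
  A + B <= A * a ^+ 2 + B * b ^+ 2 ->
  A + B <= A * (a - 1) ^+ 2 + B * (b - 1) ^+ 2 ->
  (a - 2^-1) * (b - 2^-1) <= - (3 / 4).
Proof.
move=> A0 B0 a1 bN1 b0 le_f le_f1.
have [a2|a2] := leP 2 a; first by nra.
have le1 : B * (1 - b ^+ 2) <= A * (a ^+ 2 - 1) by lra.
have le2 : A * (a * (2 - a)) <= B * (b * (b - 2)) by lra.
have c0 : 0 < a * (2 - a) by nra.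
have d0 : 0 < a ^+ 2 - 1 by nra.
have ABle : B * ((1 - b ^+ 2) * (a * (2 - a)))
            <= B * ((a ^+ 2 - 1) * (b * (b - 2))).
  have := ler_wpM2r (ltW c0) le1; have := ler_wpM2r (ltW d0) le2; lra.
rewrite (ler_pM2l B0) -subr_ge0 in ABle.
have fact : (a ^+ 2 - 1) * (b * (b - 2)) - (1 - b ^+ 2) * (a * (2 - a))
            = (a - b) * (a + b - 2 - 2 * a * b) by ring.
rewrite fact pmulr_rge0 in ABle; last by lra.
lra.
Qed.

Lemma unorm_le (R : realType) (F : fieldExtType rat)
    (sigma sigma' : {rmorphism F -> R}) (u : R * R) (g h : F) :
  (unorm sigma sigma' u g <= unorm sigma sigma' u h) =
  (u.1 ^+ 2 * sigma g ^+ 2 + u.2 ^+ 2 * sigma' g ^+ 2 <=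
   u.1 ^+ 2 * sigma h ^+ 2 + u.2 ^+ 2 * sigma' h ^+ 2).
Proof. by rewrite ler_sqrt // addr_ge0 // mulr_ge0 ?sqr_ge0. Qed.

(** Two embeddings separating [f] show that [1] and [f] are linearly
    independent over the integers, so [1] extends to a basis of the lattice. *)
Lemma primitive1_Zspan1 (R : realType) (F : fieldExtType rat)
    (sigma sigma' : {rmorphism F -> R}) (f : F) :
  sigma f != sigma' f -> primitive1 (Zspan1 f).
Proof.
move=> f_sep; split; first by exists 1, 0; rewrite mul0r addr0.
move=> d d_ge2 [m [n dE]].
have d_neq0 : d%:R != 0 :> R by rewrite pnatr_eq0; case: d d_ge2 {dE}.
have im (s : {rmorphism F -> R}) : d%:R^-1 = m%:~R + n%:~R * s f.
  by have := congr1 s dE; rewrite fmorphV rmorph_nat rmorphD rmorphM !rmorph_int.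
have n0 : n = 0.
  apply/eqP; rewrite -(intr_eq0 R); apply: contraR f_sep => n_neq0.
  by apply/eqP/(mulfI n_neq0)/(addrI m%:~R); rewrite -!im.
have /(congr1 absz) : d%:Z * m = 1.
  apply: (@intr_inj R); have := im sigma.
  by rewrite n0 mul0r addr0 intrM => <-; rewrite divff.
rewrite abszM /= => /eqP.
by rewrite muln_eq1 => /andP[/eqP d1]; rewrite d1 in d_ge2.
Qed.

Theorem corollary4p1 (R : realType) (F : fieldExtType rat)
    (F_quadratic : \dim {:F} = 2%N)
    (Delta : int) (F_disc : is_discriminant F Delta) (Delta_gt0 : 0 < Delta)
    (sqrtDelta : F) (sqrtDeltaE : sqrtDelta ^+ 2 = Delta%:~R)
    (sigma sigma' : {rmorphism F -> R})
    (sigmaE : sigma sqrtDelta = Num.sqrt (Delta%:~R : R))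
    (sigma'E : sigma' sqrtDelta = - Num.sqrt (Delta%:~R : R))
    (I : set F) (I_ideal : fractional_ideal I)
    (I_reduced : reduced sigma sigma' I)
    (f : F) (I_f : I = Zspan1 f)
    (f_gt1 : 1 < sigma f) (f'_gtN1 : -1 < sigma' f) (f'_lt0 : sigma' f < 0) :
  ~ one_reduced sigma sigma' I <->
  quad_norm sigma sigma' (f - 2^-1) > - (3 / 4).
Proof.
have img (s : {rmorphism F -> R}) (m n : int) :
    s (m%:~R + n%:~R * f) = m%:~R + n%:~R * s f.
  by rewrite rmorphD rmorphM !rmorph_int.
have im2 (s : {rmorphism F -> R}) : s (f - 2^-1) = s f - 2^-1.
  by rewrite rmorphB fmorphV rmorph_nat.
have ba : sigma' f < sigma f by lra.
rewrite /quad_norm !im2; split=> [not_red | N_gt [_ [u [u1 u2 u_min]]]].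
- rewrite ltNge; apply/negP => N_le; apply: not_red.
  split.
    by rewrite I_f; apply: (@primitive1_Zspan1 _ _ sigma sigma'); rewrite gt_eqF.
  (* The squares of these weights put the point [z] of the form above 1/2. *)
  exists (Num.sqrt (2^-1 - sigma' f), Num.sqrt (sigma f - 2^-1)).
  split=> /=; [by rewrite sqrtr_gt0; lra.. |].
  move=> g; rewrite I_f => -[m [n ->]] g_neq0.
  rewrite unorm_le /= !sqr_sqrtr; [|lra|lra].
  rewrite !rmorph1 !expr1n !mulr1 !img.
  have -> : 2^-1 - sigma' f + (sigma f - 2^-1) = sigma f - sigma' f by ring.
  apply: midpoint_form_lower_bound => //.
  by apply: contraNneq g_neq0 => -[-> ->]; rewrite mul0r addr0.
- have If : I f by rewrite I_f; exists 0, 1; rewrite mul1r add0r.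
  have If1 : I (f - 1) by rewrite I_f; exists (-1), 1; rewrite mul1r addrC.
  have f_neq0 : f != 0.
    by apply/eqP => f0; move: f_gt1; rewrite f0 rmorph0 ltr10.
  have f1_neq0 : f - 1 != 0.
    by rewrite subr_eq0; apply/eqP => f1; move: f_gt1; rewrite f1 rmorph1 ltxx.
  have := u_min _ If f_neq0; have := u_min _ If1 f1_neq0.
  rewrite !unorm_le !rmorphB !rmorph1 !expr1n !mulr1 => le_f1 le_f.
  move: N_gt; rewrite ltNge => /negP; apply.
  by apply: (weights_force_norm_bound _ _ _ _ _ le_f le_f1); rewrite ?exprn_gt0.
Qed.
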